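(* Let $A, B, C, D \in \mathbb{C}$ with $A = re^{i\theta}$ and $C = ue^{i\phi}$, where $r, u \geq 0$ and $\theta, \phi \in \mathbb{R}$. Then the solution sets of the two inequalities $AZ - B \geq 0$ and $CZ - D \geq 0$ are $e^{-i\theta}\,\mathscr{D}(B/r)$ and $e^{-i\phi}\,\mathscr{D}(D/u)$ respectively, and the solution set of the system $AZ - B \geq 0$, $CZ - D \geq 0$ is $$\mathscr{S} = \{Z \in \mathbb{C} : AZ - B \geq 0 \text{ and } CZ - D \geq 0\} = \left[e^{-i\theta}\,\mathscr{D}(B/r)\right] \cap \left[e^{-i\phi}\,\mathscr{D}(D/u)\right],$$ which is the intersection of two half planes.
   Context: The relation $\geq$ on $\mathbb{C}$ is defined as follows: for $A = a_1 + a_2 i$, $B = b_1 + b_2 i$ with $a_1,a_2,b_1,b_2 \in \mathbb{R}$, $A \geq B$ means: $a_1 > b_1$, or ($a_1 = b_1$ and $a_2 \geq b_2$). For $A \in \mathbb{C}$, $\mathscr{D}(A) := \{Z \in \mathbb{C} : Z \geq A\}$, a half plane (semi-open and semi-closed) bounded by the vertical line $\{Z \in \mathbb{C} : \operatorname{Re} Z = \operatorname{Re} A\}$. For $\mathscr{B} \subset \mathbb{C}$ and $\theta \in \mathbb{R}$, the rotation set is $e^{i\theta}\mathscr{B} := \{Ze^{i\theta} : Z \in \mathscr{B}\}$.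
   Formalization: The claims involving B/r are made only for r ≠ 0 and those involving D/u only for u ≠ 0, since these quotients are undefined at zero and the solution set is then empty or all of ℂ. *)

(* Defs.v *)
From HB Require Import structures.
From mathcomp Require Import all_boot all_order all_algebra.
From mathcomp Require Import complex.
From mathcomp Require Import classical_sets reals trigo.

Set Implicit Arguments.
Unset Strict Implicit.
Unset Printing Implicit Defensive.

Import Order.TTheory GRing.Theory Num.Theory.

Local Open Scope classical_set_scope.
Local Open Scope ring_scope.
Local Open Scope complex_scope.

Section ComplexInequalities.
Variable R : realType.
Implicit Types (A B Z : R[i]) (H S : set R[i]) (theta : R).

(* This is the total lexicographic order; the order [<=] that the library
   puts on R[i] is a different, partial one. *)
Definition lexge A B : Prop :=
  complex.Re B < complex.Re A \/
  (complex.Re A = complex.Re B /\ complex.Im B <= complex.Im A).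

Definition lex_half_plane A : set R[i] := [set Z | lexge Z A].

Definition expi theta : R[i] := cos theta +i* sin theta.

Definition rotation theta S : set R[i] := [set Z * expi theta | Z in S].

Definition dotc A B : R :=
  complex.Re A * complex.Re B + complex.Im A * complex.Im B.

(* Semi-open and semi-closed half planes: the open side, towards the normal
   [n], of the line through [P] with direction [d], together with one closed
   ray of that line. *)
Definition half_plane H : Prop :=
  exists P n d : R[i],
    [/\ n != 0, d != 0, dotc n d = 0 &
        H = [set Z | 0 < dotc n (Z - P)]
            `|` [set P + t%:C * d | t in [set t : R | 0 <= t]]].

End ComplexInequalities.

(* Main.v *)
Require Import Defs.
From HB Require Import structures.
From mathcomp Require Import all_boot all_order all_algebra.
From mathcomp Require Import complex.
From mathcomp Require Import classical_sets reals trigo.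
From mathcomp Require Import ring.

Import Order.TTheory GRing.Theory Num.Theory.

Local Open Scope classical_set_scope.
Local Open Scope ring_scope.
Local Open Scope complex_scope.

(** The inequality [A * Z - B >= 0] says [r e^(i theta) Z >= B] because the
lexicographic order is translation invariant ([lexge_subr0]), and then
[Z e^(i theta) >= B / r] because scaling by a positive real preserves the
order ([lexge_scale]).
So [Z] is a solution exactly when its rotation by [theta] lies in [D(B / r)],
that is, when [Z] lies in the rotation of [D(B / r)] by [- theta]
([mem_rotation]).

These solution sets are half planes because [D(Q)] is one, with normal [1] and
closed ray in the direction [i] ([half_plane_lex]), and rotations, being
isometries, map half planes to half planes ([half_plane_rotation]). *)

Section Rotations.
Variable R : realType.
Implicit Types (A B Q Z : R[i]) (H S : set R[i]) (t k : R).

Lemma expiNK t : expi (- t) * expi t = 1.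
Proof.
rewrite /expi cosN sinN; apply/eqP; rewrite eq_complex /=; apply/andP.
by split; apply/eqP; [rewrite -(cos2Dsin2 t)|]; ring.
Qed.

Lemma expiKN t : expi t * expi (- t) = 1.
Proof. by rewrite mulrC expiNK. Qed.

Lemma expi_neq0 t : expi t != 0.
Proof.
by apply/eqP => t0; move/eqP: (expiNK t); rewrite t0 mulr0 eq_sym oner_eq0.
Qed.

(** The inverse rotation removes the existential from a membership in a rotated
set. *)
Lemma mem_rotation t S Z : rotation t S Z <-> S (Z * expi (- t)).
Proof.
split=> [[W SW <-]|SZ]; first by rewrite -mulrA expiKN mulr1.
by exists (Z * expi (- t)) => //; rewrite -mulrA expiNK mulr1.
Qed.

Lemma dotc_rotation t A B : dotc (A * expi t) (B * expi t) = dotc A B.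
Proof.
case: A B => [a1 a2] [b1 b2]; rewrite /dotc /expi /=.
by rewrite -[RHS]mulr1 -(cos2Dsin2 t); ring.
Qed.

Lemma lexge_subr0 A B : lexge (A - B) 0 <-> lexge A B.
Proof.
case: A B => [a1 a2] [b1 b2]; rewrite /lexge /= subr_gt0 subr_ge0.
split=> -[|[ab h]]; [by left| |by left|]; right; split=> //.
  exact: subr0_eq.
by rewrite ab subrr.
Qed.

Lemma lexge_scale k A B : 0 < k -> lexge (k%:C * A) (k%:C * B) <-> lexge A B.
Proof.
case: A B => [a1 a2] [b1 b2] k0; rewrite /lexge /= !mul0r !subr0 !addr0.
rewrite ltr_pM2l // ler_pM2l //.
split=> -[|[e h]]; [by left| |by left|]; right; split=> //; last by rewrite e.
exact: (mulfI (lt0r_neq0 k0)).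
Qed.

Lemma half_plane_lex Q : half_plane (lex_half_plane Q).
Proof.
exists Q, 1, 'i; split; [exact: oner_neq0|exact: neq0Ci| |].
  by rewrite /dotc /= mulr0 mul0r addr0.
apply/seteqP; split=> [[x y]|[x y]]; case: Q => [a b];
  rewrite /lex_half_plane /lexge /dotc /= mul1r mul0r addr0 subr_gt0.
  case=> [|[-> ab]]; [by left|right].
  exists (y - b); first by rewrite /= subr_ge0.
  by apply/eqP; rewrite eq_complex /=; apply/andP; split; apply/eqP; ring.
case=> [|[t /= t0 [<- <-]]]; [by left|right].
by rewrite !mulr0 !mul0r mulr1 subrr !addr0 lerDl.
Qed.

(** The point, the normal and the direction turn together with the set, and
[dotc_rotation] keeps the defining inequality and the orthogonality. *)
Lemma half_plane_rotation t H : half_plane H -> half_plane (rotation t H).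
Proof.
move=> [P [n [d [n0 d0 nd ->]]]].
exists (P * expi t), (n * expi t), (d * expi t); split.
- by rewrite mulf_neq0 ?expi_neq0.
- by rewrite mulf_neq0 ?expi_neq0.
- by rewrite dotc_rotation.
apply/seteqP; split=> Z.
  case=> W [nW|[s s0 <-]] <-; [left|right].
    by rewrite /= -mulrBl dotc_rotation.
  by exists s; rewrite // mulrA -mulrDl.
move=> HZ; apply/mem_rotation; case: HZ => [nZ|[s s0 <-]]; [left|right].
  rewrite /= -(dotc_rotation t) mulrBl -(mulrA Z) expiNK mulr1.
  exact: nZ.
by exists s; rewrite // mulrA -mulrDl -mulrA expiKN mulr1.
Qed.

(** Dividing by [k] respects the lexicographic order, whereas dividing by
[expi t] does not; the argument of the coefficient is therefore moved onto the
solution set, as a rotation. *)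
Lemma solution_set_rotation k t B : 0 < k ->
  [set Z | lexge (k%:C * expi t * Z - B) 0]
    = rotation (- t) (lex_half_plane (B / k%:C)).
Proof.
move=> k0; have kC : k%:C != 0 :> R[i] by rewrite eq_complex /= eqxx andbT gt_eqF.
have solE Z : lexge (k%:C * expi t * Z - B) 0 <->
    rotation (- t) (lex_half_plane (B / k%:C)) Z.
  apply: (iff_trans (lexge_subr0 _ _)).
  apply: (iff_trans _ (iff_sym (mem_rotation _ _ _))).
  apply: (iff_trans _ (lexge_scale _ _ _ k0)).
  by rewrite opprK (mulrC _ (B / _)) divfK // -mulrA (mulrC Z).
by apply/seteqP; split=> Z /solE.
Qed.

End Rotations.

(* The quotients B / r and D / u only have a meaning for r != 0 and u != 0,
   so each claim is made under exactly the conditions it needs to be defined. *)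
Theorem mainTheorem10 (R : realType) (A B C D : R[i]) (r u theta phi : R)
    (hr : 0 <= r) (hu : 0 <= u)
    (hA : A = r%:C * expi theta) (hC : C = u%:C * expi phi) :
  [/\ r != 0 ->
        [set Z | lexge (A * Z - B) 0]
          = rotation (- theta) (lex_half_plane (B / r%:C))
        /\ half_plane (rotation (- theta) (lex_half_plane (B / r%:C))),
      u != 0 ->
        [set Z | lexge (C * Z - D) 0]
          = rotation (- phi) (lex_half_plane (D / u%:C))
        /\ half_plane (rotation (- phi) (lex_half_plane (D / u%:C)))
    & r != 0 -> u != 0 ->
        [set Z | lexge (A * Z - B) 0 /\ lexge (C * Z - D) 0]
          = rotation (- theta) (lex_half_plane (B / r%:C))
            `&` rotation (- phi) (lex_half_plane (D / u%:C))].
Proof.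
have sol k t E : 0 <= k -> k != 0 ->
    [set Z | lexge (k%:C * expi t * Z - E) 0]
      = rotation (- t) (lex_half_plane (E / k%:C)).
  by move=> k0 kn0; apply: solution_set_rotation; rewrite lt_def kn0.
rewrite hA hC; split=> [r0|u0|r0 u0].
- by split; [exact: sol|exact/half_plane_rotation/half_plane_lex].
- by split; [exact: sol|exact/half_plane_rotation/half_plane_lex].
by rewrite -!sol.
Qed.
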